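(* Let $r>0$ be a constant and let $\beta$ be a unit-speed spacelike or timelike center curve in $E_1^4$ with non-null Frenet frame $\{F_1,F_2,F_3,F_4\}$; the index $j\in\{1,2,3,4\}$ indicates that $F_j$ is the timelike frame vector. The tubular hypersurfaces $\mathfrak{T}^{\{j;\lambda\}}(s,t,w)$ which are formed as the envelope of a family of pseudo hyperspheres ($\lambda=1$) or pseudo hyperbolic hyperspheres ($\lambda=-1$) in $E_1^4$ generated by spacelike or timelike center curves can be parametrized by $$\begin{aligned} \mathfrak{T}^{\{1;1\}}&=\beta\mp r\left(\cos t\cos w\,F_2+\sin t\cos w\,F_3+\sin w\,F_4\right),\\ \mathfrak{T}^{\{2;1\}}&=\beta\mp r\left(\cosh t\sinh w\,F_2+\cosh w\,F_3+\sinh t\sinh w\,F_4\right),\\ \mathfrak{T}^{\{2;-1\}}&=\beta\mp r\left(\cosh t\cosh w\,F_2+\sinh w\,F_3+\sinh t\cosh w\,F_4\right),\\ \mathfrak{T}^{\{3;1\}}&=\beta\mp r\left(\sinh t\sinh w\,F_2+\cosh t\sinh w\,F_3+\cosh w\,F_4\right),\\ \mathfrak{T}^{\{3;-1\}}&=\beta\mp r\left(\sinh t\cosh w\,F_2+\cosh t\cosh w\,F_3+\sinh w\,F_4\right),\\ \mathfrak{T}^{\{4;1\}}&=\beta\mp r\left(\cosh w\,F_2+\sinh t\sinh w\,F_3+\cosh t\sinh w\,F_4\right),\\ \mathfrak{T}^{\{4;-1\}}&=\beta\mp r\left(\sinh w\,F_2+\sinh t\cosh w\,F_3+\cosh t\cosh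 w\,F_4\right). \end{aligned}$$ Also, there is no tubular hypersurface $\mathfrak{T}^{\{1;-1\}}(s,t,w)$ which is formed as the envelope of a family of pseudo hyperbolic hyperspheres in $E_1^4$ generated by timelike center curves. Furthermore, the tubular hypersurfaces $\mathfrak{T}^{\{j;0\}}(s,t,w)$ which are formed as the envelope of a family of null hypercones in $E_1^4$ generated by spacelike or timelike center curves can be parametrized by $$\begin{aligned} \mathfrak{T}^{\{2;0\}}&=\beta\mp\sqrt{a_3^2+a_4^2}\,F_2+a_3F_3+a_4F_4,\\ \mathfrak{T}^{\{3;0\}}&=\beta+a_2F_2\mp\sqrt{a_2^2+a_4^2}\,F_3+a_4F_4,\\ \mathfrak{T}^{\{4;0\}}&=\beta+a_2F_2+a_3F_3\mp\sqrt{a_2^2+a_3^2}\,F_4, \end{aligned}$$ where the $a_i=a_i(s,t,w)$ are arbitrary functions.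
   Context: $E_1^4$ is $\mathbb{R}^4$ with the inner product $g(x,y)=\langle x,y\rangle=-x_1y_1+x_2y_2+x_3y_3+x_4y_4$. For $p\in E_1^4$: the pseudo hypersphere, pseudo hyperbolic hypersphere, and null hypercone centered at $p$ are $\{x:\langle x-p,x-p\rangle=\lambda r^2\}$ for $\lambda=1,-1,0$ respectively. $\beta:I\to E_1^4$ ($I$ an open interval) is smooth with $\beta'=F_1$, the $F_i$ are smooth, pairwise orthogonal, $g(F_i,F_i)=\varepsilon_i$ with $\varepsilon_j=-1$ and $\varepsilon_i=1$ for $i\neq j$ (so $\beta$ is timelike if $j=1$ and spacelike if $j=2,3,4$), and $$F_1'=k_1F_2,\quad F_2'=\varepsilon_3\varepsilon_4k_1F_1+k_2F_3,\quad F_3'=\varepsilon_1\varepsilon_4k_2F_2+k_3F_4,\quad F_4'=\varepsilon_1\varepsilon_2k_3F_3$$ with smooth functions $k_1,k_2,k_3$. A tubular hypersurface formed as the envelope of the family (a canal hypersurface with constant radius) is a parametrized hypersurface $X(s,t,w)$ such that $\langle X-\beta(s),X-\beta(s)\rangle=\lambda r^2$ and $X-\beta(s)$ is normal to the hypersurface. In all displayed formulas $\beta$ and the $F_i$ are evaluated at $s$, and $\mp$ denotes either choice of sign.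
   Formalization: For λ=1 and j=2,3,4, that every tubular hypersurface has the displayed form is asserted only where the coordinate carrying cosh w exceeds r in absolute value (it fails elsewhere); for null hypercones the sign ∓ is chosen pointwise, and is constant if the hypersurface never meets β(s). *)

(* Defs.v *)
From HB Require Import structures.
From mathcomp Require Import all_boot all_order all_algebra.
From mathcomp Require Import all_classical all_reals all_analysis.

Set Implicit Arguments.
Unset Strict Implicit.
Unset Printing Implicit Defensive.

Import Order.TTheory GRing.Theory Num.Theory.
Import numFieldNormedType.Exports.
Local Open Scope classical_set_scope.
Local Open Scope ring_scope.

(* Frame vectors and coordinates are numbered from 1 in the mathematics, while
   'I_4 starts at 0. *)
Definition i1 : 'I_4 := @Ordinal 4 0 isT.
Definition i2 : 'I_4 := @Ordinal 4 1 isT.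
Definition i3 : 'I_4 := @Ordinal 4 2 isT.
Definition i4 : 'I_4 := @Ordinal 4 3 isT.

Section Defs.
Variable R : realType.
Local Notation E := 'rV[R]_4.

Definition cosh (x : R) : R := (expR x + expR (- x)) / 2.
Definition sinh (x : R) : R := (expR x - expR (- x)) / 2.

Definition g (x y : E) : R :=
  - (x 0 i1 * y 0 i1) + x 0 i2 * y 0 i2 + x 0 i3 * y 0 i3 + x 0 i4 * y 0 i4.

(* Pseudo hypersphere, pseudo hyperbolic hypersphere and null hypercone centered
   at p, for lam = 1, -1, 0 respectively. *)
Definition hyperquadric (lam r : R) (p : E) : set E :=
  [set x | g (x - p) (x - p) = lam * r ^+ 2].

Definition smooth_curve (V : normedModType R) (I : set R) (f : R -> V) : Prop :=
  forall (n : nat) (s : R), I s -> derivable (derive1n n f) s 1.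

Definition eps (j i : 'I_4) : R := if i == j then -1 else 1.

(* beta is a unit-speed curve on I with non-null Frenet frame F, whose vector of
   index j is the timelike one. *)
Record frenet_curve (I : set R) (j : 'I_4) (beta : R -> E)
    (F : 'I_4 -> R -> E) (k1 k2 k3 : R -> R) : Prop := FrenetCurve {
  frenet_beta_smooth : smooth_curve I beta;
  frenet_F_smooth : forall i, smooth_curve I (F i);
  frenet_k1_smooth : smooth_curve I k1;
  frenet_k2_smooth : smooth_curve I k2;
  frenet_k3_smooth : smooth_curve I k3;
  frenet_tangent : forall s, I s -> derive1 beta s = F i1 s;
  frenet_orthonormal : forall s, I s -> forall a b,
    g (F a s) (F b s) = if a == b then eps j a else 0;
  frenet_F1 : forall s, I s -> derive1 (F i1) s = k1 s *: F i2 s;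
  frenet_F2 : forall s, I s ->
    derive1 (F i2) s = (eps j i3 * eps j i4 * k1 s) *: F i1 s + k2 s *: F i3 s;
  frenet_F3 : forall s, I s ->
    derive1 (F i3) s = (eps j i1 * eps j i4 * k2 s) *: F i2 s + k3 s *: F i4 s;
  frenet_F4 : forall s, I s ->
    derive1 (F i4) s = (eps j i1 * eps j i2 * k3 s) *: F i3 s
}.

(* Parameters (s, t, w) are points of R * R * R; the partial derivatives are the
   directional derivatives along the canonical basis. *)
Definition axis (i : 'I_3) : R * R * R :=
  [:: (1, 0, 0); (0, 1, 0); (0, 0, 1)]`_i.

Definition partial (i : 'I_3) (X : R * R * R -> E) : R * R * R -> E :=
  fun p => 'D_(axis i) X p.

(* C^infinity on the open set D: all iterated partial derivatives, in any order,
   exist and are continuous at the points of D. *)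
Definition smooth_on (D : set (R * R * R)) (X : R * R * R -> E) : Prop :=
  forall (l : seq 'I_3) (p : R * R * R), D p ->
    {for p, continuous (foldr partial X l)} /\
    forall i, derivable (foldr partial X l) p (axis i).

Definition regular_at (X : R * R * R -> E) (p : R * R * R) : Prop :=
  row_free (\matrix_(i < 3) partial i X p).

Definition parameter_domain (I : set R) (D : set (R * R * R)) : Prop :=
  [/\ open D, connected D, D !=set0 & forall p, D p -> I p.1.1].

(* Singular points are allowed (a tube parametrization such as the spherical one
   is singular where cos w = 0), but they have empty interior. *)
Definition parametrized_hypersurface (I : set R) (D : set (R * R * R))
    (X : R * R * R -> E) : Prop :=
  [/\ parameter_domain I D, smooth_on D X &
      D `<=` closure [set p | D p /\ regular_at X p]].

Definition tubular_hypersurface (lam r : R) (I : set R) (beta : R -> E)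
    (D : set (R * R * R)) (X : R * R * R -> E) : Prop :=
  [/\ parametrized_hypersurface I D X,
      forall p, D p -> hyperquadric lam r (beta p.1.1) (X p) &
      forall p, D p -> forall i, g (X p - beta p.1.1) (partial i X p) = 0].

(* The sign of the displayed formulas is (-1) ^+ b, for either boolean b. *)
Section Parametrizations.
Variables (r : R) (beta : R -> E) (F : 'I_4 -> R -> E) (b : bool).

Definition T11 : R * R * R -> E := fun '(s, t, w) =>
  beta s + (-1) ^+ b *: (r *: ((cos t * cos w) *: F i2 s
    + (sin t * cos w) *: F i3 s + sin w *: F i4 s)).

Definition T21 : R * R * R -> E := fun '(s, t, w) =>
  beta s + (-1) ^+ b *: (r *: ((cosh t * sinh w) *: F i2 s
    + cosh w *: F i3 s + (sinh t * sinh w) *: F i4 s)).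

Definition T2m1 : R * R * R -> E := fun '(s, t, w) =>
  beta s + (-1) ^+ b *: (r *: ((cosh t * cosh w) *: F i2 s
    + sinh w *: F i3 s + (sinh t * cosh w) *: F i4 s)).

Definition T31 : R * R * R -> E := fun '(s, t, w) =>
  beta s + (-1) ^+ b *: (r *: ((sinh t * sinh w) *: F i2 s
    + (cosh t * sinh w) *: F i3 s + cosh w *: F i4 s)).

Definition T3m1 : R * R * R -> E := fun '(s, t, w) =>
  beta s + (-1) ^+ b *: (r *: ((sinh t * cosh w) *: F i2 s
    + (cosh t * cosh w) *: F i3 s + sinh w *: F i4 s)).

Definition T41 : R * R * R -> E := fun '(s, t, w) =>
  beta s + (-1) ^+ b *: (r *: (cosh w *: F i2 s
    + (sinh t * sinh w) *: F i3 s + (cosh t * sinh w) *: F i4 s)).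

Definition T4m1 : R * R * R -> E := fun '(s, t, w) =>
  beta s + (-1) ^+ b *: (r *: (sinh w *: F i2 s
    + (sinh t * cosh w) *: F i3 s + (cosh t * cosh w) *: F i4 s)).

Definition T20 (a3 a4 : R * R * R -> R) : R * R * R -> E := fun p =>
  beta p.1.1 + ((-1) ^+ b * Num.sqrt (a3 p ^+ 2 + a4 p ^+ 2)) *: F i2 p.1.1
  + a3 p *: F i3 p.1.1 + a4 p *: F i4 p.1.1.

Definition T30 (a2 a4 : R * R * R -> R) : R * R * R -> E := fun p =>
  beta p.1.1 + a2 p *: F i2 p.1.1
  + ((-1) ^+ b * Num.sqrt (a2 p ^+ 2 + a4 p ^+ 2)) *: F i3 p.1.1
  + a4 p *: F i4 p.1.1.

Definition T40 (a2 a3 : R * R * R -> R) : R * R * R -> E := fun p =>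
  beta p.1.1 + a2 p *: F i2 p.1.1 + a3 p *: F i3 p.1.1
  + ((-1) ^+ b * Num.sqrt (a2 p ^+ 2 + a3 p ^+ 2)) *: F i4 p.1.1.

End Parametrizations.

(* T parametrizes the tubular hypersurfaces of type lam that satisfy C: each T b
   is a tubular hypersurface on every parameter domain, and every tubular
   hypersurface satisfying C is obtained from one T b by a change of the
   parameters t and w. *)
Definition parametrizes (lam r : R) (I : set R) (beta : R -> E)
    (T : bool -> R * R * R -> E)
    (C : set (R * R * R) -> (R * R * R -> E) -> Prop) : Prop :=
  (forall b D, parameter_domain I D ->
     tubular_hypersurface lam r I beta D (T b)) /\
  (forall D X, tubular_hypersurface lam r I beta D X -> C D X ->
     exists b, forall s t w, D (s, t, w) ->
       exists t' w', X (s, t, w) = T b (s, t', w')).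

(* Same for families depending on two arbitrary functions a, a'. The sign may
   change only across points where X meets the vertex beta of the cone. *)
Definition parametrizes_null (r : R) (I : set R) (beta : R -> E)
    (T : bool -> (R * R * R -> R) -> (R * R * R -> R) -> R * R * R -> E) : Prop :=
  (forall b a a' D, parametrized_hypersurface I D (T b a a') ->
     tubular_hypersurface 0 r I beta D (T b a a')) /\
  (forall D X, tubular_hypersurface 0 r I beta D X ->
     exists a a',
       (forall p, D p -> exists b, X p = T b a a' p) /\
       ((forall p, D p -> X p <> beta p.1.1) ->
          exists b, forall p, D p -> X p = T b a a' p)).

Definition everywhere (D : set (R * R * R)) (X : R * R * R -> E) : Prop := True.

(* For lam = 1 and j <> 1, the component along the frame vector with coefficient
   r cosh w must exceed r in absolute value. Points violating this are not reached
   by the parametrization, except those with w = 0; the hyperboloid of one sheet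
   is thus only partly covered. *)
Definition exceeds (r : R) (beta : R -> E) (Fi : R -> E)
    (D : set (R * R * R)) (X : R * R * R -> E) : Prop :=
  forall p, D p -> r < `|g (X p - beta p.1.1) (Fi p.1.1)|.

End Defs.

(* Main.v *)
Require Import Defs.
From HB Require Import structures.
From mathcomp Require Import all_boot all_order all_algebra.
From mathcomp Require Import all_classical all_reals all_analysis.
From mathcomp Require Import ring lra.
Import Order.TTheory GRing.Theory Num.Theory.
Import numFieldNormedType.Exports.
Local Open Scope classical_set_scope.
Local Open Scope ring_scope.

(** Let N = X - beta. Differentiating <N, N> = lam r^2 along s, t and w shows that
    N is orthogonal to the hypersurface exactly when <N, F_1> = 0 ([tubularP]).
    A tubular hypersurface is therefore a choice, over each s, of points of the
    quadric <N, N> = lam r^2 of the three-dimensional normal space spanned by F_2,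
    F_3, F_4, and everything reduces to parametrizing that quadric.

    Write x, y, z for the normal coordinates along F_a, F_b, F_c, where F_a is the
    timelike vector if it is normal. The quadric is -k x^2 + y^2 + z^2 = lam r^2,
    with k = -1 for a timelike beta and k = 1 otherwise: a sphere or the empty set
    in the first case, a hyperboloid of one or two sheets or a cone in the second.
    All the parametrizations of nonzero type have the same form: x, y, z are, up to
    sign, r A(t) phi(w), r B(t) phi(w), r psi(w), where (A, B) and (phi, psi) are
    pairs of circular or hyperbolic functions, with derivatives (k S, C) for a pair
    (C, S) and with S^2 - k C^2 constant ([conic_pair]). One computation thus deals
    with all of them.

    That these formulas define hypersurfaces requires smoothness and a dense set
    of regular points. Differentiating <N, F_1> = 0 gives
    <X_s, F_1> = eps_1 - k_1 <N, F_2>, so a point is regular when this number and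
    phi are nonzero ([tube_regular]). For fixed s and t both are affine in solutions
    of f'' = k f, and such a solution is nowhere locally constant unless it is 0
    there: a small change of w restores regularity ([conic_generic]).

    Conversely, the normal coordinates of a given tubular hypersurface determine t
    and w by explicit inverses ([sphere_onto], [two_sheets_onto],
    [one_sheet_onto]). The sign is the same everywhere because the coordinate that
    carries it is continuous and nonvanishing on the connected domain
    ([constant_sign]); on the cone this fails only at the vertex. *)

Set Implicit Arguments.
Unset Strict Implicit.
Unset Printing Implicit Defensive.

Local Notation axis_s := (@Ordinal 3 0 isT).
Local Notation axis_t := (@Ordinal 3 1 isT).
Local Notation axis_w := (@Ordinal 3 2 isT).

(** * Partial derivatives of separated functions *)

Section Slices.
Variable R : realType.

(** A directional derivative only sees the restriction to a line; this turns
    every partial derivative below into a one-variable derivative. *)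
Lemma is_derive_slice (V W : normedModType R) (X : V -> W) (Y : R -> W)
    (p v : V) (s : R) (d : W) :
  (forall h, X (h *: v + p) = Y (h + s)) -> is_derive s 1 Y d ->
  is_derive p v X d.
Proof.
move=> XY [dY <-].
have q : (fun h : R => h^-1 *: ((X \o shift p) (h *: v) - X p)) =
         (fun h : R => h^-1 *: ((Y \o shift s) (h *: 1) - Y s)).
  apply/funext => h /=; rewrite XY [h *: 1]mulr1.
  by have := XY 0; rewrite scale0r !add0r => ->.
split; first by rewrite /derivable q.
by rewrite /derive q.
Qed.

Lemma is_derive_scalar_curve (V : normedModType R) (k : R -> R) (v : V)
    (x dk : R) :
  is_derive x 1 k dk -> is_derive x 1 (fun y => k y *: v) (dk *: v).
Proof.
move=> [dfk <-].
have dk' : differentiable k x by apply/derivable1_diffP.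
split; first by apply/derivable1_diffP/differentiableZl.
rewrite deriveE; last exact: differentiableZl.
by rewrite diffZl// -deriveE.
Qed.

(** The tubes are sums of products that separate the variables s, t and w, a
    shape stable under all partial derivatives. *)
Definition term (V : normedModType R) (u v : R -> R) (f : R -> V)
  (p : R * R * R) : V := (u p.1.2 * v p.2) *: f p.1.1.

Lemma is_derive_term_s (V : normedModType R) (u v : R -> R) (f : R -> V)
    (p : R * R * R) :
  derivable f p.1.1 1 ->
  is_derive p (axis R axis_s) (term u v f) (term u v (derive1 f) p).
Proof.
move=> df; apply: (@is_derive_slice _ _ _
  (fun s => (u p.1.2 * v p.2) *: f s) _ _ p.1.1).
  by move=> h; rewrite /term /axis/= ?scaler0 ?add0r [h *: 1]mulr1.
apply: is_deriveZ; rewrite derive1E; exact/derivableP.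
Qed.

Lemma is_derive_term_t (V : normedModType R) (u v : R -> R) (f : R -> V)
    (p : R * R * R) :
  derivable u p.1.2 1 ->
  is_derive p (axis R axis_t) (term u v f) (term (derive1 u) v f p).
Proof.
move=> df; apply: (@is_derive_slice _ _ _
  (fun s => (u s * v p.2) *: f p.1.1) _ _ p.1.2).
  by move=> h; rewrite /term /axis/= ?scaler0 ?add0r [h *: 1]mulr1.
apply: is_derive_scalar_curve.
have := derivableP df.
rewrite -derive1E => du.
have -> : (fun s => u s * v p.2) = v p.2 \*: u.
  by apply/funext => s /=; exact: mulrC.
by rewrite mulrC; exact: is_deriveZ.
Qed.

Lemma is_derive_term_w (V : normedModType R) (u v : R -> R) (f : R -> V)
    (p : R * R * R) :
  derivable v p.2 1 ->
  is_derive p (axis R axis_w) (term u v f) (term u (derive1 v) f p).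
Proof.
move=> df; apply: (@is_derive_slice _ _ _
  (fun s => (u p.1.2 * v s) *: f p.1.1) _ _ p.2).
  by move=> h; rewrite /term /axis/= ?scaler0 ?add0r [h *: 1]mulr1.
apply: is_derive_scalar_curve.
have := derivableP df.
rewrite -derive1E => du.
exact: (is_deriveZ (u p.1.2) du).
Qed.

Lemma ord3_ind (P : 'I_3 -> Prop) : P axis_s ->
  P axis_t -> P axis_w -> forall i, P i.
Proof.
move=> P0 P1 P2 [[|[|[|//]]] lt3].
- by rewrite (_ : Ordinal lt3 = axis_s)//; apply: val_inj.
- by rewrite (_ : Ordinal lt3 = axis_t)//; apply: val_inj.
- by rewrite (_ : Ordinal lt3 = axis_w)//; apply: val_inj.
Qed.

Lemma partial_term (V : normedModType R) (I : set R) (i : 'I_3) l m n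
    (u v : R -> R) (f : R -> V) :
  smooth_curve setT u -> smooth_curve setT v -> smooth_curve I f ->
  exists l' m' n', forall p, I p.1.1 ->
  is_derive p (axis R i) (term (derive1n l u) (derive1n m v) (derive1n n f))
    (term (derive1n l' u) (derive1n m' v) (derive1n n' f) p).
Proof.
move=> su sv sf; elim/ord3_ind: i.
- by exists l, m, n.+1 => p Ip; apply: is_derive_term_s; exact: sf.
- by exists l.+1, m, n => p Ip; apply: is_derive_term_t; exact: su.
- by exists l, m.+1, n => p Ip; apply: is_derive_term_w; exact: sv.
Qed.

Lemma smooth_continuous (V : normedModType R) (I : set R) (f : R -> V) n s :
  smooth_curve I f -> I s -> {for s, continuous (derive1n n f)}.
Proof.
by move=> sf Is; apply/differentiable_continuous/derivable1_diffP; exact: sf.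
Qed.

Lemma is_derive_curve_s (V : normedModType R) (f : R -> V) (p : R * R * R) :
  derivable f p.1.1 1 ->
  is_derive p (axis R axis_s) (fun q => f q.1.1) (derive1 f p.1.1).
Proof.
move=> df; apply: (is_derive_slice (Y := f) (s := p.1.1)).
  by move=> h; rewrite /axis/= [h *: 1]mulr1.
by rewrite derive1E; exact/derivableP.
Qed.

Lemma is_derive_curve_cst (V : normedModType R) (f : R -> V) (p : R * R * R) i :
  i != axis_s ->
  is_derive p (axis R i) (fun q => f q.1.1) 0.
Proof.
move=> i0; apply: (is_derive_slice (Y := cst (f p.1.1)) (s := 0)).
by move: i0; elim/ord3_ind: i => // _ h; rewrite /axis/= ?scaler0 ?add0r.
Qed.

Lemma continuous_s (V : normedModType R) (f : R -> V) (p : R * R * R) :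
  {for p.1.1, continuous f} -> {for p, continuous (fun q => f q.1.1)}.
Proof.
move=> cf; apply: (@continuous_comp _ _ _ (fun q : R * R * R => q.1.1)) => //.
by apply: (@cvg_comp _ _ _ fst fst); exact: cvg_fst.
Qed.

Lemma continuous_t (V : normedModType R) (f : R -> V) (p : R * R * R) :
  {for p.1.2, continuous f} -> {for p, continuous (fun q => f q.1.2)}.
Proof.
move=> cf; apply: (@continuous_comp _ _ _ (fun q : R * R * R => q.1.2)) => //.
by apply: (@cvg_comp _ _ _ fst snd); [exact: cvg_fst|exact: cvg_snd].
Qed.

Lemma continuous_w (V : normedModType R) (f : R -> V) (p : R * R * R) :
  {for p.2, continuous f} -> {for p, continuous (fun q => f q.2)}.
Proof.
move=> cf; apply: (@continuous_comp _ _ _ (fun q : R * R * R => q.2)) => //.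
exact: cvg_snd.
Qed.

Lemma term_continuous (V : normedModType R) (I : set R) l m n (u v : R -> R)
    (f : R -> V) (p : R * R * R) :
  smooth_curve setT u -> smooth_curve setT v -> smooth_curve I f -> I p.1.1 ->
  {for p, continuous (term (derive1n l u) (derive1n m v) (derive1n n f))}.
Proof.
move=> su sv sf Ip.
have cf := continuous_s (smooth_continuous (n := n) sf Ip).
have cu : {for p, continuous (fun q => derive1n l u q.1.2)}.
  by apply: continuous_t; exact: smooth_continuous su _.
have cv : {for p, continuous (fun q => derive1n m v q.2)}.
  by apply: continuous_w; exact: smooth_continuous sv _.
by rewrite /term; apply: cvgZ => //; apply: cvgM.
Qed.

End Slices.

(** * Smooth maps on an open set of parameters *)

Section Smooth.
Variable R : realType.
Local Notation E := 'rV[R]_4.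

Lemma near_open (D : set (R * R * R)) (P : R * R * R -> Prop) (p : R * R * R) :
  open D -> D p -> (forall q, D q -> P q) -> \forall q \near p, P q.
Proof.
move=> oD Dp DP; have : nbhs p D by exact: open_nbhs_nbhs.
by apply: filterS.
Qed.

Lemma eq_on_is_derive (V : normedModType R) (D : set (R * R * R))
    (X Y : R * R * R -> V) p v d :
  open D -> (forall q, D q -> X q = Y q) -> D p ->
  is_derive p v Y d -> is_derive p v X d.
Proof.
move=> oD XY Dp; apply: near_eq_is_derive.
by apply: (near_open oD Dp) => q Dq; rewrite XY.
Qed.

Lemma eq_on_continuous (V : normedModType R) (D : set (R * R * R))
    (X Y : R * R * R -> V) p :
  open D -> (forall q, D q -> X q = Y q) -> D p ->
  {for p, continuous Y} -> {for p, continuous X}.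
Proof.
move=> oD XY Dp; rewrite /prop_for /continuous_at XY// => cY.
apply: cvg_trans cY; apply: near_eq_cvg.
by apply: (near_open oD Dp) => q Dq; rewrite XY.
Qed.

(** Every iterated partial derivative of a separated product is again one, with
    each factor replaced by one of its derivatives. As f is controlled on I only,
    this equality holds on D only, and D open makes it enough to differentiate
    again. *)
Lemma smooth_on_term (I : set R) (D : set (R * R * R)) (u v : R -> R)
    (f : R -> E) :
  smooth_curve setT u -> smooth_curve setT v -> smooth_curve I f ->
  open D -> (forall p, D p -> I p.1.1) -> smooth_on D (term u v f).
Proof.
move=> su sv sf oD DI l.
have [a [b [c Xl]]] : exists a b c, forall p, D p ->
    foldr (@partial R) (term u v f) l p =
    term (derive1n a u) (derive1n b v) (derive1n c f) p.
  elim: l => [|i l [a [b [c IH]]]]; first by exists 0%N, 0%N, 0%N.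
  have [a' [b' [c' H]]] := partial_term i a b c su sv sf.
  exists a', b', c' => p Dp /=; rewrite /partial.
  have := eq_on_is_derive oD IH Dp (H _ (DI _ Dp)).
  by move=> /@derive_val.
move=> p Dp; split.
  by apply: (eq_on_continuous oD Xl Dp); exact: term_continuous sf (DI _ Dp).
move=> i; have [a' [b' [c' H]]] := partial_term i a b c su sv sf.
by have [] := eq_on_is_derive oD Xl Dp (H _ (DI _ Dp)).
Qed.

Lemma smooth_onD (D : set (R * R * R)) (X Y : R * R * R -> E) :
  open D -> smooth_on D X -> smooth_on D Y -> smooth_on D (X \+ Y).
Proof.
move=> oD sX sY l.
have XYl p : D p -> foldr (@partial R) (X \+ Y) l p =
    (foldr (@partial R) X l \+ foldr (@partial R) Y l) p.
  elim: l p => [//|i l IH] p Dp /=; rewrite /partial.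
  have [_ /(_ i)/derivableP dX] := sX l p Dp.
  have [_ /(_ i)/derivableP dY] := sY l p Dp.
  have := eq_on_is_derive oD IH Dp (is_deriveD dX dY).
  by move=> /@derive_val.
move=> p Dp.
have [cX dX] := sX l p Dp; have [cY dY] := sY l p Dp.
split; first by apply: (eq_on_continuous oD XYl Dp); exact: continuousD.
move=> i; have := eq_on_is_derive oD XYl Dp
  (is_deriveD (derivableP (dX i)) (derivableP (dY i))).
by case.
Qed.

End Smooth.

(** * The Lorentzian inner product *)

Section Metric.
Variable R : realType.
Local Notation E := 'rV[R]_4.

Lemma gC (x y : E) : g x y = g y x.
Proof. by rewrite /g; ring. Qed.

Lemma gDl (x y z : E) : g (x + y) z = g x z + g y z.
Proof. by rewrite /g !mxE; ring. Qed.

Lemma gZl k (x y : E) : g (k *: x) y = k * g x y.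
Proof. by rewrite /g !mxE; ring. Qed.

Lemma gDr (x y z : E) : g z (x + y) = g z x + g z y.
Proof. by rewrite gC gDl !(gC z). Qed.

Lemma gZr k (x y : E) : g y (k *: x) = k * g y x.
Proof. by rewrite gC gZl (gC y). Qed.

Lemma gBl (x y z : E) : g (x - y) z = g x z - g y z.
Proof. by rewrite gDl -scaleN1r gZl mulN1r. Qed.

Lemma gBr (x y z : E) : g z (x - y) = g z x - g z y.
Proof. by rewrite gC gBl !(gC z). Qed.

Lemma is_derive_coord (V : normedModType R) (X : V -> E) (p v : V) d k :
  is_derive p v X d -> is_derive p v (fun q => X q 0 k) (d 0 k).
Proof.
move=> [dX <-]; split; first by have /derivable_mxP := dX; apply.
by rewrite derive_mx// mxE.
Qed.

Lemma is_derive_g (V : normedModType R) (X Y : V -> E) (p v : V) dX dY :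
  is_derive p v X dX -> is_derive p v Y dY ->
  is_derive p v (fun q => g (X q) (Y q)) (g dX (Y p) + g (X p) dY).
Proof.
move=> hX hY.
have hM k := is_deriveM (is_derive_coord k hX) (is_derive_coord k hY).
have := is_deriveD (is_deriveD (is_deriveD (is_deriveN (hM i1)) (hM i2))
  (hM i3)) (hM i4).
by move=> /is_derive_eq; apply; rewrite /g /GRing.scale /=; ring.
Qed.

Lemma continuous_g (T : topologicalType) (X Y : T -> E) (p : T) :
  {for p, continuous X} -> {for p, continuous Y} ->
  {for p, continuous (fun q => g (X q) (Y q))}.
Proof.
move=> cX cY.
have cc (Z : T -> E) k : {for p, continuous Z} ->
    {for p, continuous (fun q => Z q 0 k)}.
  move=> cZ; apply: (@continuous_comp _ _ _ Z (fun M : E => M 0 k)) => //.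
  exact: coord_continuous.
rewrite /g; apply: continuousD; last by apply: continuousM; exact: cc.
apply: continuousD; last by apply: continuousM; exact: cc.
apply: continuousD; last by apply: continuousM; exact: cc.
by apply: continuousN; apply: continuousM; exact: cc.
Qed.

(** If M has rows G i, and J and e are the diagonal matrices of signs, then
    orthonormality reads M (J M^T e) = 1. A one-sided inverse of a square matrix
    is two-sided, so (J M^T e) M = 1, which is the expansion. *)
Lemma frame_expansion (G : 'I_4 -> E) (e : 'I_4 -> R) (x : E) :
  (forall i, e i ^+ 2 = 1) ->
  (forall a b, g (G a) (G b) = if a == b then e a else 0) ->
  x = \sum_i (e i * g x (G i)) *: G i.
Proof.
move=> e2 oG.
pose M : 'M[R]_4 := \matrix_i G i.
pose J : 'M[R]_4 := diag_mx (\row_i (if i == i1 then -1 else 1)).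
have gE (y z : E) : g y z = (y *m J *m z^T) 0 0.
  rewrite mxE; under eq_bigr do rewrite mul_mx_diag !mxE.
  by rewrite !big_ord_recl big_ord0 /g/= !mulr1 mulrN1 mulNr addr0 !addrA;
    congr (- _ + _ + _ + _); congr (_ * _); congr (_ _ _); apply: val_inj.
pose N : 'M[R]_4 := J *m M^T *m diag_mx (\row_i e i).
have MN : M *m N = 1%:M.
  apply/matrixP => a b; rewrite /N !mulmxA mul_mx_diag mxE.
  have -> : (M *m J *m M^T) a b = g (G a) (G b).
    by rewrite gE !mul_mx_diag !mxE; apply: eq_bigr => k _; rewrite !mxE.
  rewrite oG !mxE; case: eqVneq => [->|_]; last by rewrite mul0r.
  by rewrite -expr2 e2.
have NM := mulmx1C MN.
rewrite -[LHS]mulmx1 -NM mulmxA mulmx_sum_row; apply: eq_bigr => i _.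
rewrite rowK; congr (_ *: _).
rewrite /N !mulmxA mul_mx_diag !mxE mulrC; congr (_ * _).
by rewrite gE !mul_mx_diag !mxE; apply: eq_bigr => k _; rewrite !mxE.
Qed.

End Metric.

(** * Circular and hyperbolic functions, and parametrizations of quadrics *)

Section Conics.
Variable R : realType.

(** The curve (C, S) moves along the conic S^2 - k C^2 = m by its natural flow:
    k = -1 gives circles, k = 1 hyperbolas. This one shape covers (cos, sin),
    (cosh, sinh) and (sinh, cosh), both in t and in w. *)
Definition conic_pair (k m : R) (C S : R -> R) : Prop :=
  [/\ forall x : R, is_derive x 1 C (k * S x),
      forall x : R, is_derive x 1 S (C x) &
      forall x : R, S x ^+ 2 - k * C x ^+ 2 = m].

Lemma conic_trig : conic_pair (-1) 1 cos sin.
Proof.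
split=> [x|x|x]; first by rewrite mulN1r; exact: is_derive_cos.
  exact: is_derive_sin.
by rewrite mulN1r opprK addrC cos2Dsin2.
Qed.

Lemma is_derive_expRN (x : R) :
  is_derive x 1 (fun y => expR (- y)) (- expR (- x)).
Proof.
have := is_derive1_comp (is_derive_expR (- x)) (is_deriveNid x 1).
by rewrite mulrN1.
Qed.

Lemma is_derive_cosh (x : R) : is_derive x 1 (@cosh R) (sinh x).
Proof.
have -> : @cosh R = 2^-1 \*: (expR + fun y => expR (- y)).
  by apply/funext => y; rewrite /cosh mulrC.
by rewrite /sinh mulrC; apply: is_deriveZ; apply: is_deriveD (is_derive_expRN x).
Qed.

Lemma is_derive_sinh (x : R) : is_derive x 1 (@sinh R) (cosh x).
Proof.
have -> : @sinh R = 2^-1 \*: (expR - fun y => expR (- y)).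
  by apply/funext => y; rewrite /sinh mulrC.
rewrite /cosh mulrC; apply: is_deriveZ.
rewrite -[expR (- x)]opprK.
by apply: is_deriveD; apply: is_deriveN (is_derive_expRN x).
Qed.

Lemma cosh2Bsinh2 (x : R) : cosh x ^+ 2 - sinh x ^+ 2 = 1.
Proof.
have := expRxMexpNx_1 x; rewrite /cosh /sinh => ee.
by rewrite -[RHS]ee; field.
Qed.

Lemma cosh_gt0 (x : R) : 0 < cosh x.
Proof. by rewrite /cosh divr_gt0// addr_gt0// expR_gt0. Qed.

Lemma conic_cosh_sinh : conic_pair 1 (-1) (@cosh R) (@sinh R).
Proof.
split=> [x|x|x]; first by rewrite mul1r; exact: is_derive_cosh.
  exact: is_derive_sinh.
by rewrite mul1r -(cosh2Bsinh2 x) opprB.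
Qed.

Lemma conic_sinh_cosh : conic_pair 1 1 (@sinh R) (@cosh R).
Proof.
split=> [x|x|x]; first by rewrite mul1r; exact: is_derive_sinh.
  exact: is_derive_cosh.
by rewrite mul1r cosh2Bsinh2.
Qed.

Lemma conic_scale k m c C S : conic_pair k m C S ->
  conic_pair k (c ^+ 2 * m) (fun x => c * C x) (fun x => c * S x).
Proof.
move=> [dC dS CS]; split=> x.
- by rewrite mulrCA; exact: is_deriveZ.
- exact: is_deriveZ.
- by rewrite -(CS x); ring.
Qed.

Section ConicPair.
Variables (k m : R) (C S : R -> R).
Hypothesis CS : conic_pair k m C S.

Definition conic_lin (a b x : R) : R := a * C x + b * S x.

Lemma conic_lin_derive a b (x : R) :
  is_derive x 1 (conic_lin a b) (conic_lin b (k * a) x).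
Proof.
have [dC dS _] := CS.
have := is_deriveD (is_deriveZ a (dC x)) (is_deriveZ b (dS x)).
by move=> /is_derive_eq; apply; rewrite /conic_lin /GRing.scale/=; ring.
Qed.

Lemma conic_lin_smooth a b : smooth_curve setT (conic_lin a b).
Proof.
move=> n s _.
suff [a' [b' ->]] : exists a' b', derive1n n (conic_lin a b) = conic_lin a' b'.
  by have [] := conic_lin_derive a' b' s.
elim: n => [|n [a' [b' IH]]]; first by exists a, b.
exists b', (k * a'); rewrite derive1nS IH; apply/funext => x.
by rewrite derive1E; have [_ ->] := conic_lin_derive a' b' x.
Qed.

Lemma conic_smoothl : smooth_curve setT C.
Proof.
have -> : C = conic_lin 1 0 by apply/funext => x; rewrite /conic_lin; ring.
exact: conic_lin_smooth.
Qed.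

Lemma conic_smoothr : smooth_curve setT S.
Proof.
have -> : S = conic_lin 0 1 by apply/funext => x; rewrite /conic_lin; ring.
exact: conic_lin_smooth.
Qed.

Lemma conic_lin_near a b c (x : R) : (\forall y \near x, conic_lin a b y = c) ->
  \forall y \near x, conic_lin b (k * a) y = 0.
Proof.
move=> /near_join; apply: filterS => y nc.
have := near_eq_derive (1 : R) nc.
by rewrite derive_cst; have [_ ->] := conic_lin_derive a b y.
Qed.

Hypothesis k_neq0 : k != 0.

(** Combinations of C and S solve f'' = k f; where f is locally constant, f'' = 0
    and hence f = 0. *)
Lemma conic_lin_locally_cst a b c (x : R) :
  (\forall y \near x, conic_lin a b y = c) -> c = 0.
Proof.
move=> nc; have n2 := conic_lin_near (conic_lin_near nc).
have := nbhs_singleton n2; rewrite /= -(nbhs_singleton nc) /conic_lin.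
have -> : k * a * C x + k * b * S x = k * (a * C x + b * S x) by ring.
by move/eqP; rewrite mulf_eq0 (negPf k_neq0) => /eqP.
Qed.

Hypothesis m_neq0 : m != 0.

(** If C vanished near x, so would its derivative k S, and S^2 - k C^2 would be
    0 instead of m. *)
Lemma conic_locally_neq0 (x : R) : ~ \forall y \near x, C y = 0.
Proof.
move=> nC; have nC1 : \forall y \near x, conic_lin 1 0 y = 0.
  by apply: filterS nC => y Cy; rewrite /conic_lin Cy; ring.
have := nbhs_singleton (conic_lin_near nC1).
rewrite /= /conic_lin mul0r add0r mulr1; move/eqP.
rewrite mulf_eq0 (negPf k_neq0) /= => /eqP Sx.
have [_ _ /(_ x)] := CS; rewrite (nbhs_singleton nC) Sx => /eqP.
by rewrite expr0n/= mulr0 subr0 eq_sym (negPf m_neq0).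
Qed.

(** Both conditions are open and hold at points arbitrarily close to x, so they
    can be reached in turn. They are what regularity of a tube amounts to. *)
Lemma conic_generic a b c (x : R) (U : set R) : c != 0 -> nbhs x U ->
  exists y, [/\ U y, C y != 0 & conic_lin a b y != c].
Proof.
move=> c0; rewrite nbhsE => -[V [oV Vx] VU].
have [y [Vy Cy]] : exists y, V y /\ C y != 0.
  apply: contrapT => nV; apply: (@conic_locally_neq0 x).
  have : nbhs x V by exact: open_nbhs_nbhs.
  apply: filterS => y Vy; apply/eqP; apply: contrapT => /negP Cy.
  by apply: nV; exists y.
have nC : \forall z \near y, C z != 0.
  have cC : {for y, continuous C}.
    by have [dC _ _] := CS; apply/differentiable_continuous/derivable1_diffP.
  exact: (cvgr_neq0 (C y) cC Cy).
apply: contrapT => nU; move: c0; apply/negP/negPn/eqP.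
apply: (@conic_lin_locally_cst a b c y).
have : nbhs y V by exact: open_nbhs_nbhs.
move: nC; apply: filterS2 => z Cz Vz.
apply/eqP; apply: contrapT => /negP zc; apply: nU; exists z; split => //.
exact: VU.
Qed.

End ConicPair.

(** The preimage of y is ln (y + sqrt (1 + y^2)). *)
Lemma sinh_onto (y : R) : exists t, sinh t = y.
Proof.
pose z := y + Num.sqrt (1 + y ^+ 2).
have sq : Num.sqrt (1 + y ^+ 2) ^+ 2 = 1 + y ^+ 2.
  by rewrite sqr_sqrtr// addr_ge0// sqr_ge0.
have z0 : 0 < z.
  have : - y < Num.sqrt (1 + y ^+ 2).
    have y2 := sqr_ge0 y.
    by rewrite (le_lt_trans (ler_norm _))// normrN -sqrtr_sqr ltr_sqrt; lra.
  rewrite /z; lra.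
exists (ln z); rewrite /sinh expRN lnK//.
have -> : z^-1 = Num.sqrt (1 + y ^+ 2) - y.
  apply: (mulfI (lt0r_neq0 z0)); rewrite divff ?lt0r_neq0// /z; move: sq.
  by set s := Num.sqrt _ => sq; ring: sq.
by rewrite /z; field.
Qed.

Lemma polar (x y : R) : exists t,
  x = Num.sqrt (x ^+ 2 + y ^+ 2) * cos t /\
  y = Num.sqrt (x ^+ 2 + y ^+ 2) * sin t.
Proof.
set d := Num.sqrt _.
have d2 : d ^+ 2 = x ^+ 2 + y ^+ 2 by rewrite sqr_sqrtr// addr_ge0// sqr_ge0.
have [d0|d0] := eqVneq d 0.
  exists 0; rewrite d0 !mul0r; move: d2; rewrite d0 expr0n/= => /esym/eqP.
  by rewrite paddr_eq0 ?sqr_ge0// !sqrf_eq0 => /andP[/eqP -> /eqP ->].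
have dp : 0 < d by rewrite lt_neqAle eq_sym d0 sqrtr_ge0.
have xd : -1 <= x / d <= 1.
  rewrite -ler_norml normrM normfV (gtr0_norm dp) ler_pdivrMr// mul1r.
  rewrite -(gtr0_norm dp) -ler_sqr ?nnegrE// !real_normK ?num_real// d2.
  by rewrite lerDl sqr_ge0.
pose t := acos (x / d).
have ct : cos t = x / d by rewrite acosK// in_itv/=.
have st : (d * sin t) ^+ 2 = y ^+ 2.
  rewrite exprMn sin2cos2 ct expr_div_n mulrBr mulr1 mulrCA divff ?expf_neq0//.
  by rewrite d2 mulr1 addrC addKr.
have dc : x = d * cos t by rewrite ct mulrC divfK.
have /eqP := st; rewrite eqf_sqr => /orP[/eqP s|/eqP s].
  by exists t.
by exists (- t); rewrite cosN sinN mulrN s opprK.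
Qed.

Lemma sphere_onto (x y z : R) : x ^+ 2 + y ^+ 2 + z ^+ 2 = 1 ->
  exists t w, [/\ x = cos t * cos w, y = sin t * cos w & z = sin w].
Proof.
move=> h; have [t [xt yt]] := polar x y.
have [w [cw sw]] := polar (Num.sqrt (x ^+ 2 + y ^+ 2)) z.
move: cw sw; rewrite sqr_sqrtr ?addr_ge0 ?sqr_ge0// h sqrtr1 !mul1r => cw sw.
by exists t, w; rewrite -cw -sw; split; rewrite // mulrC.
Qed.

(** The scale c may be negative: the condition 0 < x * c puts (x / c, y / c) on
    the branch that (cosh, sinh) covers. *)
Lemma hyperbola_onto (x y c : R) : x ^+ 2 - y ^+ 2 = c ^+ 2 -> 0 < x * c ->
  exists t, x = cosh t * c /\ y = sinh t * c.
Proof.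
move=> h xc; have c0 : c != 0.
  by apply: contraTneq xc => ->; rewrite mulr0 ltxx.
have [t st] := sinh_onto (y / c).
have yt : y = sinh t * c by rewrite st divfK.
exists t; split=> //; have := cosh2Bsinh2 t; have := cosh_gt0 t => cp ct.
have : x ^+ 2 == (cosh t * c) ^+ 2.
  apply/eqP; rewrite exprMn.
  have -> : cosh t ^+ 2 = 1 + sinh t ^+ 2 by lra.
  by rewrite mulrDl mul1r -exprMn -yt -h; ring.
rewrite eqf_sqr => /orP[/eqP//|/eqP xE].
move: xc; rewrite xE mulNr -mulrA -expr2 oppr_gt0 pmulr_rlt0// ltNge sqr_ge0//.
Qed.

Lemma two_sheets_onto (x y z : R) : x ^+ 2 - y ^+ 2 - z ^+ 2 = 1 -> 0 < x ->
  exists t w, [/\ x = cosh t * cosh w, y = sinh t * cosh w & z = sinh w].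
Proof.
move=> h x0; have [w zw] := sinh_onto z; have := cosh2Bsinh2 w => cw.
have [||t [xt yt]] := @hyperbola_onto x y (cosh w).
- by rewrite zw in cw; lra.
- by rewrite mulr_gt0// cosh_gt0.
by exists t, w.
Qed.

(** Here x^2 - y^2 = z^2 - 1 > 0 leaves the sign of sinh w free; it is chosen to
    be that of x, since cosh t > 0. *)
Lemma one_sheet_onto (x y z : R) : - x ^+ 2 + y ^+ 2 + z ^+ 2 = 1 -> 1 < z ->
  exists t w, [/\ x = cosh t * sinh w, y = sinh t * sinh w & z = cosh w].
Proof.
move=> h z1.
have zz : 0 < z ^+ 2 - 1 by rewrite subr_gt0 expr_gt1// ltW// (lt_trans _ z1).
have x2 : 0 < x ^+ 2 by have := sqr_ge0 y; lra.
have x0 : x != 0 by apply: contraTneq x2 => ->; rewrite expr0n ltxx.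
pose d := Num.sqrt (z ^+ 2 - 1).
have d2 : d ^+ 2 = z ^+ 2 - 1 by rewrite sqr_sqrtr// ltW.
have d0 : 0 < d by rewrite sqrtr_gt0.
have [w sw] := sinh_onto (Num.sg x * d).
have sw2 : sinh w ^+ 2 = z ^+ 2 - 1.
  by rewrite sw exprMn sqr_sg x0 mul1r.
have zw : z = cosh w.
  have := cosh2Bsinh2 w; rewrite sw2 => cw; have cp := cosh_gt0 w.
  apply/eqP; rewrite -(@eqrXn2 _ 2)// ?ltW// ?(lt_trans _ z1)//; apply/eqP; lra.
have [||t [xt yt]] := @hyperbola_onto x y (sinh w).
- by rewrite sw2; lra.
- by rewrite sw mulrA [x * _]mulrC -normrEsg mulr_gt0// normr_gt0.
by exists t, w.
Qed.

(** The image of D is an interval that avoids 0. *)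
Lemma constant_sign (T : topologicalType) (D : set T) (f : T -> R) :
  connected D -> (forall p, D p -> {for p, continuous f}) ->
  (forall p, D p -> f p != 0) ->
  exists b : bool, forall p, D p -> 0 < (-1) ^+ b * f p.
Proof.
move=> cD cf f0.
have : connected (f @` D).
  apply: connected_continuous_connected => //.
  by apply: continuous_in_subspaceT => p /set_mem; exact: cf.
move=> /connected_intervalP iD.
have [[p [Dp fp]]|np] := pselect (exists p, D p /\ f p < 0).
  exists true => q Dq; rewrite expr1 mulN1r oppr_gt0 ltNge; apply/negP => fq.
  have [z Dz fz] : (f @` D) 0.
    apply: (iD (f p) (f q)); [by exists p|by exists q|].
    by rewrite (ltW fp).
  by have := f0 z Dz; rewrite fz eqxx.
exists false => q Dq; rewrite expr0 mul1r lt_neqAle eq_sym f0//= leNgt.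
by apply/negP => fq; apply: np; exists q.
Qed.

End Conics.

(** * Envelopes, tubes and null cones *)

Section Envelope.
Variable R : realType.
Local Notation E := 'rV[R]_4.
Variables (I : set R) (j : 'I_4) (beta : R -> E) (F : 'I_4 -> R -> E).
Variables (k1 k2 k3 : R -> R).
Hypothesis frenet : frenet_curve I j beta F k1 k2 k3.

Lemma sum_ord3 (V : nmodType) (f : 'I_3 -> V) :
  \sum_i f i = f axis_s + (f axis_t + f axis_w).
Proof.
rewrite !big_ord_recl big_ord0 addr0.
by congr (f _ + (f _ + f _)); exact: val_inj.
Qed.

Definition offset (X : R * R * R -> E) (q : R * R * R) : E := X q - beta q.1.1.

Lemma is_derive_offset X p i : I p.1.1 -> derivable X p (axis R i) ->
  is_derive p (axis R i) (offset X)
    (partial i X p - (if i == axis_s then F i1 p.1.1 else 0)).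
Proof.
move=> Ip /derivableP dX.
suff dbeta : is_derive p (axis R i) (fun q => beta q.1.1)
    (if i == axis_s then F i1 p.1.1 else 0) by exact: is_deriveB dX dbeta.
case: eqVneq => [->|]; last exact: is_derive_curve_cst.
rewrite -(frenet_tangent frenet Ip); apply: is_derive_curve_s.
exact: (frenet_beta_smooth frenet (n := 0%N)).
Qed.

Section Domain.
Variable D : set (R * R * R).
Hypothesis domD : parameter_domain I D.

Lemma eq_on_derive_cst (f : R * R * R -> R) c p v d :
  (forall q, D q -> f q = c) -> D p -> is_derive p v f d -> d = 0.
Proof.
have [oD _ _ _] := domD => fc Dp df.
have [_ <-] := df.
by have [_] := eq_on_is_derive oD fc Dp (is_derive_cst c p v).
Qed.

(** Differentiating <X - beta, X - beta> = lam r^2, where the derivative of beta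
    is F_1 in the direction s and 0 in the others. *)
Lemma offset_partial lam r X p i : smooth_on D X ->
  (forall q, D q -> hyperquadric lam r (beta q.1.1) (X q)) -> D p ->
  g (offset X p) (partial i X p) =
  if i == axis_s then g (offset X p) (F i1 p.1.1) else 0.
Proof.
move=> sX hX Dp; have [_ _ _ DI] := domD.
have [_ dX] := sX [::] p Dp.
have dN := is_derive_offset (DI _ Dp) (dX i).
have /eqP := eq_on_derive_cst (f := fun q => g (offset X q) (offset X q)) hX Dp
  (is_derive_g dN dN).
rewrite [X in X + _]gC -mulr2n mulrn_eq0/= gBr subr_eq0 => /eqP ->.
by case: eqVneq => // _; rewrite -(scale0r 0) gZr mul0r.
Qed.

(** The envelope condition: among hypersurfaces made of points of the quadrics,
    the tubular ones are those with X - beta in the normal space of beta. *)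
Lemma tubularP lam r X : parametrized_hypersurface I D X ->
  (forall q, D q -> hyperquadric lam r (beta q.1.1) (X q)) ->
  tubular_hypersurface lam r I beta D X <->
  (forall q, D q -> g (offset X q) (F i1 q.1.1) = 0).
Proof.
move=> pX hX; have [_ sX _] := pX; split=> [[_ _ oX] q Dq|nX].
  by rewrite -(oX q Dq axis_s) (offset_partial axis_s sX hX Dq).
split=> // p Dp i; rewrite -[LHS]/(g (offset X p) _) (offset_partial i sX hX Dp).
by case: ifP => // _; exact: nX.
Qed.

(** Differentiating <X - beta, F_1> = 0 and using F_1' = k_1 F_2. *)
Lemma partial_tangent X p i : smooth_on D X ->
  (forall q, D q -> g (offset X q) (F i1 q.1.1) = 0) -> D p ->
  g (partial i X p) (F i1 p.1.1) =
  if i == axis_s then eps R j i1 - k1 p.1.1 * g (offset X p) (F i2 p.1.1) else 0.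
Proof.
move=> sX hX Dp; have [_ _ _ DI] := domD; have Ip := DI _ Dp.
have [_ dX] := sX [::] p Dp.
have dN := is_derive_offset Ip (dX i).
have dF : is_derive p (axis R i) (fun q => F i1 q.1.1)
    (if i == axis_s then k1 p.1.1 *: F i2 p.1.1 else 0).
  case: eqVneq => [->|]; last exact: is_derive_curve_cst.
  rewrite -(frenet_F1 frenet Ip); apply: is_derive_curve_s.
  exact: (frenet_F_smooth frenet (n := 0%N)).
have := eq_on_derive_cst hX Dp (is_derive_g dN dF); rewrite gBl.
have g0 x : g x (0 : E) = 0 by rewrite -(scale0r 0) gZr mul0r.
have := frenet_orthonormal frenet Ip i1 i1; rewrite eqxx => oF.
case: eqVneq => _; last by rewrite [g 0 _]gC !g0 subr0 addr0.
by rewrite gZr oF; lra.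
Qed.

End Domain.

Section AdaptedFrame.
Variables (a b c : 'I_4).
Hypothesis abc : uniq [:: i1; a; b; c].
Hypothesis ja : j \in [:: i1; a].
(** The frame vectors F_2, F_3, F_4 are listed as F_a, F_b, F_c with F_b and F_c
    spacelike. The normal part of the metric is then -k x^2 + y^2 + z^2 with k
    this number: k = 1 when F_a is timelike, and k = -1 when F_1 is. *)
Definition signature : R := - eps R j a.
Local Notation k := signature.

Lemma signature_neq0 : k != 0.
Proof. by rewrite /k /eps; case: ifP; rewrite ?opprK ?oppr_eq0 oner_eq0. Qed.

Lemma mem_adapted i : i \in [:: i1; a; b; c].
Proof.
have /subset_cardP/(_ (subset_predT _)) -> // : #|[:: i1; a; b; c]| = #|'I_4|.
by rewrite (card_uniqP abc) card_ord.
Qed.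

Lemma eps_b : eps R j b = 1.
Proof.
rewrite /eps; case: eqVneq => // bj; move: ja abc; rewrite -bj /= !inE.
by move=> /orP[/eqP->|/eqP->]; rewrite eqxx ?orbT ?andbF.
Qed.

Lemma eps_c : eps R j c = 1.
Proof.
rewrite /eps; case: eqVneq => // cj; move: ja abc; rewrite -cj /= !inE.
by move=> /orP[/eqP->|/eqP->]; rewrite eqxx ?orbT ?andbF.
Qed.

Lemma adapted_gram s : I s ->
  [/\ g (F a s) (F a s) = - k, g (F b s) (F b s) = 1, g (F c s) (F c s) = 1 &
   [/\ g (F a s) (F b s) = 0, g (F a s) (F c s) = 0, g (F b s) (F c s) = 0 &
   [/\ g (F a s) (F i1 s) = 0, g (F b s) (F i1 s) = 0 &
       g (F c s) (F i1 s) = 0]]].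
Proof.
move=> Is; move: abc; rewrite /= !inE !negb_or.
move=> /andP[/and3P[ia ib ic] /andP[/andP[ab ac] /andP[bc _]]].
have oF := frenet_orthonormal frenet Is.
rewrite !oF !eqxx eps_b eps_c opprK [a == i1]eq_sym [b == i1]eq_sym.
rewrite [c == i1]eq_sym.
by rewrite (negPf ia) (negPf ib) (negPf ic) (negPf ab) (negPf ac) (negPf bc).
Qed.

Definition normal_comb s (x y z : R) : E :=
  x *: F a s + y *: F b s + z *: F c s.

Lemma g_normal_comb s x y z : I s ->
  [/\ g (normal_comb s x y z) (F i1 s) = 0,
      g (normal_comb s x y z) (F a s) = - k * x,
      g (normal_comb s x y z) (F b s) = y &
      g (normal_comb s x y z) (F c s) = z].
Proof.
move=> /adapted_gram[aa bb cc [ab ac bc [ai bi ci]]].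
rewrite /normal_comb !gDl !gZl aa bb cc ab ac bc ai bi ci.
rewrite [g (F b s) _]gC [g (F c s) (F a s)]gC [g (F c s) (F b s)]gC ab ac bc.
by split; ring.
Qed.

Lemma g_normal_comb_self s x y z : I s ->
  g (normal_comb s x y z) (normal_comb s x y z) =
  - k * x ^+ 2 + y ^+ 2 + z ^+ 2.
Proof.
move=> Is; have [_ ga gb gc] := g_normal_comb x y z Is.
by rewrite {2}/normal_comb !gDr !gZr ga gb gc; ring.
Qed.

Lemma normal_expansion s (v : E) : I s -> g v (F i1 s) = 0 ->
  v = normal_comb s (- k * g v (F a s)) (g v (F b s)) (g v (F c s)).
Proof.
move=> Is v1.
have e2 i : eps R j i ^+ 2 = 1 by rewrite /eps; case: ifP; rewrite ?sqrrN expr1n.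
rewrite [LHS](frame_expansion v e2 (frenet_orthonormal frenet Is)).
rewrite (eq_bigl (mem [:: i1; a; b; c])); last by move=> i; rewrite /= mem_adapted.
rewrite -big_uniq// !big_cons big_nil /= v1 mulr0 scale0r add0r addr0.
by rewrite eps_b eps_c !mul1r /signature opprK addrA.
Qed.

Section Tube.
Variables (A B phi psi : R -> R) (lam c0 : R).
Hypothesis AB : conic_pair k (- k * c0 ^+ 2) A B.
Hypothesis PP : conic_pair k lam phi psi.
Hypothesis c0_neq0 : c0 != 0.
Hypothesis lam_neq0 : lam != 0.

(** The common shape of all the parametrizations of nonzero type: (A, B) turns
    (F_a, F_b) and (phi, psi) turns the result with F_c. The signed radius c0 is
    absorbed in A and B. *)
Definition tube (p : R * R * R) : E :=
  beta p.1.1 + normal_comb p.1.1 (A p.1.2 * phi p.2) (B p.1.2 * phi p.2)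
    (c0 * psi p.2).

Lemma offset_tube p : offset tube p =
  normal_comb p.1.1 (A p.1.2 * phi p.2) (B p.1.2 * phi p.2) (c0 * psi p.2).
Proof. by rewrite /offset /tube addrC addKr. Qed.

Lemma tube_terms : tube = term (cst 1) (cst 1) beta \+
  (term A phi (F a) \+ term B phi (F b) \+ term (cst c0) psi (F c)).
Proof.
by apply/funext => p; rewrite /tube /normal_comb /term /= mulr1 scale1r.
Qed.

Lemma tube_quadric p : I p.1.1 ->
  hyperquadric lam c0 (beta p.1.1) (tube p).
Proof.
move=> Ip; rewrite /hyperquadric /= -[X in g X X]/(offset tube p).
have [_ _ ABk] := AB; have [_ _ PPk] := PP.
rewrite offset_tube g_normal_comb_self// -(PPk p.2).
have -> : - k * (A p.1.2 * phi p.2) ^+ 2 + (B p.1.2 * phi p.2) ^+ 2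
  = (B p.1.2 ^+ 2 - k * A p.1.2 ^+ 2) * phi p.2 ^+ 2 by ring.
by rewrite ABk; ring.
Qed.

Lemma tube_normal p : I p.1.1 -> g (offset tube p) (F i1 p.1.1) = 0.
Proof. by move=> Ip; rewrite offset_tube; have [] := g_normal_comb
  (A p.1.2 * phi p.2) (B p.1.2 * phi p.2) (c0 * psi p.2) Ip. Qed.

Lemma smooth_cst (x : R) : smooth_curve setT (cst x : R -> R).
Proof.
move=> n s _; suff [y ->] : exists y, derive1n n (cst x : R -> R) = cst y.
  exact: derivable_cst.
elim: n => [|n [y IH]]; first by exists x.
exists 0; rewrite derive1nS IH; apply/funext => z.
by rewrite derive1E derive_cst.
Qed.

Lemma tube_smooth D : parameter_domain I D -> smooth_on D tube.
Proof.
move=> [oD _ _ DI]; rewrite tube_terms.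
have sm u v f : smooth_curve setT u -> smooth_curve setT v ->
    smooth_curve I f -> smooth_on D (term u v f : R * R * R -> E).
  by move=> su sv sf; exact: smooth_on_term sf oD DI.
have sF i := frenet_F_smooth frenet (i := i).
have sb := frenet_beta_smooth frenet.
have sA := conic_smoothl AB; have sB := conic_smoothr AB.
have sp := conic_smoothl PP; have sq := conic_smoothr PP.
have s1 := @smooth_cst 1; have sc := @smooth_cst c0.
exact: (smooth_onD oD (sm _ _ _ s1 s1 sb) (smooth_onD oD (smooth_onD oD
  (sm _ _ _ sA sp (sF a)) (sm _ _ _ sB sp (sF b))) (sm _ _ _ sc sq (sF c)))).
Qed.

Lemma partial_tube_t p : partial axis_t tube p =
  normal_comb p.1.1 (k * B p.1.2 * phi p.2) (A p.1.2 * phi p.2) 0.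
Proof.
have [dA dB _] := AB; rewrite /partial tube_terms.
have ex (u : R -> R) (x d : R) : is_derive x 1 u d -> derivable u x 1 by case.
have H1 (f : R -> E) := is_derive_term_t (cst 1) f (p := p) (u := cst 1)
  (ex _ _ _ (is_derive_cst (1 : R) p.1.2 (1 : R))).
have HA := is_derive_term_t phi (F a) (p := p) (ex _ _ _ (dA p.1.2)).
have HB := is_derive_term_t phi (F b) (p := p) (ex _ _ _ (dB p.1.2)).
have Hc := is_derive_term_t psi (F c) (p := p) (u := cst c0)
  (ex _ _ _ (is_derive_cst c0 p.1.2 (1 : R))).
have [_ ->] := is_deriveD (H1 beta) (is_deriveD (is_deriveD HA HB) Hc).
rewrite /term !derive1E !derive_cst !mul0r !scale0r add0r addr0.
have [_ ->] := dA p.1.2; have [_ ->] := dB p.1.2.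
by rewrite /normal_comb scale0r addr0.
Qed.

Lemma partial_tube_w p : partial axis_w tube p =
  normal_comb p.1.1 (A p.1.2 * (k * psi p.2)) (B p.1.2 * (k * psi p.2))
    (c0 * phi p.2).
Proof.
have [dA dB _] := PP; rewrite /partial tube_terms.
have ex (u : R -> R) (x d : R) : is_derive x 1 u d -> derivable u x 1 by case.
have H1 (f : R -> E) := is_derive_term_w (cst 1) f (p := p) (v := cst 1)
  (ex _ _ _ (is_derive_cst (1 : R) p.2 (1 : R))).
have HA := is_derive_term_w A (F a) (p := p) (ex _ _ _ (dA p.2)).
have HB := is_derive_term_w B (F b) (p := p) (ex _ _ _ (dA p.2)).
have Hc := is_derive_term_w (cst c0) (F c) (p := p) (ex _ _ _ (dB p.2)).
have [_ ->] := is_deriveD (H1 beta) (is_deriveD (is_deriveD HA HB) Hc).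
rewrite /term !derive1E !derive_cst mulr0 scale0r add0r.
by have [_ ->] := dA p.2; have [_ ->] := dB p.2.
Qed.

(** In the basis F_1, F_a, F_b, F_c the three partial derivatives form a
    triangular system: only the one along s has an F_1 component, namely
    eps_1 - k_1 <X - beta, F_2>; those along t and w are independent as soon as
    phi is nonzero. *)
Lemma tube_regular D p : parameter_domain I D -> D p -> phi p.2 != 0 ->
  k1 p.1.1 * g (offset tube p) (F i2 p.1.1) != eps R j i1 ->
  regular_at tube p.
Proof.
move=> domD Dp phi0 k10; have [_ _ _ DI] := domD; have Ip := DI _ Dp.
apply: inj_row_free => v; rewrite mulmx_sum_row sum_ord3 3!rowK.
rewrite partial_tube_t partial_tube_w.
set x : R := v 0 axis_s; set y : R := v 0 axis_t; set z : R := v 0 axis_w => v0.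
have gv w : g (x *: partial axis_s tube p + (y *: normal_comb p.1.1
  (k * B p.1.2 * phi p.2) (A p.1.2 * phi p.2) 0 + z *: normal_comb p.1.1
  (A p.1.2 * (k * psi p.2)) (B p.1.2 * (k * psi p.2)) (c0 * phi p.2))) w = 0.
  by rewrite v0 -(scale0r (0 : E)) gZl mul0r.
have [t1 ta tb _] := g_normal_comb
  (k * B p.1.2 * phi p.2) (A p.1.2 * phi p.2) 0 Ip.
have tc : g (normal_comb p.1.1 (k * B p.1.2 * phi p.2) (A p.1.2 * phi p.2) 0)
    (F c p.1.1) = 0.
  by have [] := g_normal_comb (k * B p.1.2 * phi p.2) (A p.1.2 * phi p.2) 0 Ip.
have [w1 wa wb wc] := g_normal_comb
  (A p.1.2 * (k * psi p.2)) (B p.1.2 * (k * psi p.2)) (c0 * phi p.2) Ip.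
have x0 : x = 0.
  have /eqP := gv (F i1 p.1.1); rewrite !gDl !gZl t1 w1 !mulr0 !addr0.
  rewrite (partial_tangent domD axis_s (tube_smooth domD) _ Dp); last first.
    by move=> q /DI; exact: tube_normal.
  by rewrite eqxx mulf_eq0 subr_eq0 [_ == _ * _]eq_sym (negPf k10) orbF => /eqP.
have z0 : z = 0.
  have /eqP := gv (F c p.1.1); rewrite !gDl !gZl x0 tc wc mul0r mulr0 !add0r.
  by rewrite !mulf_eq0 (negPf c0_neq0) (negPf phi0) !orbF => /eqP.
(* A and B cannot vanish together: B^2 - k A^2 = - k c0^2 is nonzero. *)
have y0 : y = 0.
  apply/eqP; apply: contrapT => /negP y0.
  have /eqP := gv (F a p.1.1); have /eqP := gv (F b p.1.1).
  rewrite !gDl !gZl x0 z0 ta tb !mul0r !add0r !addr0.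
  rewrite !mulf_eq0 oppr_eq0 (negPf y0) (negPf phi0) (negPf signature_neq0).
  rewrite !orbF /= => /eqP A0 /eqP B0.
  have [_ _ /(_ p.1.2)/eqP] := AB.
  rewrite A0 B0 expr0n/= mulr0 subr0 eq_sym mulf_eq0 oppr_eq0.
  by rewrite (negPf signature_neq0) sqrf_eq0 (negPf c0_neq0).
apply/rowP; elim/ord3_ind; rewrite !mxE.
- exact: x0.
- exact: y0.
- exact: z0.
Qed.

Lemma tube_coordinate (p : R * R * R) i : I p.1.1 -> i != i1 ->
  exists u v, forall w, g (offset tube (p.1.1, p.1.2, w)) (F i p.1.1) =
    conic_lin phi psi u v w.
Proof.
move=> Ip ii1.
have gt w := g_normal_comb (A p.1.2 * phi w) (B p.1.2 * phi w) (c0 * psi w) Ip.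
have := mem_adapted i; rewrite !inE (negPf ii1) /= => /or3P[]/eqP ->.
- exists (- k * A p.1.2), 0 => w; rewrite offset_tube.
  by have [_ -> _ _] := gt w; rewrite /conic_lin; ring.
- exists (B p.1.2), 0 => w; rewrite offset_tube.
  by have [_ _ -> _] := gt w; rewrite /conic_lin; ring.
- exists 0, c0 => w; rewrite offset_tube.
  by have [_ _ _ ->] := gt w; rewrite /conic_lin; ring.
Qed.

(** With s and t fixed, <X - beta, F_2> is a combination of phi and psi whichever
    of a, b, c is the index 2, so a small change of w alone reaches a regular
    point. *)
Lemma tube_regular_dense D : parameter_domain I D ->
  D `<=` closure [set p | D p /\ regular_at tube p].
Proof.
move=> domD [[s t] w0] Dp U Up; have [oD _ _ DI] := domD.
have [u [v guv]] := tube_coordinate (DI _ Dp) (i := i2) isT.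
have DUp : nbhs (s, t, w0) (D `&` U).
  by apply: filterI => //; exact: open_nbhs_nbhs.
have cw : (fun w => (s, t, w)) @ w0 --> (s, t, w0).
  exact: (@cvg_pair _ _ _ (nbhs w0) (nbhs (s, t)) (nbhs w0) _ _ _ _ _
    (cvg_cst (s, t)) cvg_id).
have Vw : nbhs w0 (fun w => (D `&` U) (s, t, w)) by exact: cw.
have e0 : eps R j i1 != 0.
  by rewrite /eps; case: ifP; rewrite ?oppr_eq0 oner_eq0.
have [w [[Dw Uw] phiw kw]] := conic_generic PP signature_neq0 lam_neq0
  (k1 s * u) (k1 s * v) e0 Vw.
exists (s, t, w); split=> //; split=> //.
apply: (tube_regular domD) => //=.
by rewrite guv; move: kw; rewrite /conic_lin mulrDr !mulrA.
Qed.

Lemma tube_tubular D : parameter_domain I D ->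
  tubular_hypersurface lam c0 I beta D tube.
Proof.
move=> domD; have [_ _ _ DI] := domD.
apply/(tubularP domD).
- by split=> //; [exact: tube_smooth|exact: tube_regular_dense].
- by move=> q /DI; exact: tube_quadric.
- by move=> q /DI; exact: tube_normal.
Qed.

End Tube.

(** By the envelope condition X - beta has no F_1 component, so it is the sum of
    its normal components, and the equation of the quadric only involves them. *)
Lemma tubular_offset lam r D X p :
  tubular_hypersurface lam r I beta D X -> D p ->
  offset X p = normal_comb p.1.1 (- k * g (offset X p) (F a p.1.1))
    (g (offset X p) (F b p.1.1)) (g (offset X p) (F c p.1.1)) /\
  - k * (- k * g (offset X p) (F a p.1.1)) ^+ 2
    + g (offset X p) (F b p.1.1) ^+ 2 + g (offset X p) (F c p.1.1) ^+ 2 =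
  lam * r ^+ 2.
Proof.
move=> tX Dp; have [pX qX _] := tX; have [domD _ _] := pX.
have [_ _ _ DI] := domD; have nX := (tubularP domD pX qX).1 tX _ Dp.
have e := normal_expansion (DI _ Dp) nX; split => //.
rewrite -(g_normal_comb_self _ _ _ (DI _ Dp)).
by rewrite -e; exact: (qX p Dp).
Qed.

Lemma tubular_coordinate_continuous lam r D X i p :
  tubular_hypersurface lam r I beta D X -> D p ->
  {for p, continuous (fun q => g (offset X q) (F i q.1.1))}.
Proof.
move=> [[domD sX _] _ _] Dp; have [_ _ _ DI] := domD; have Ip := DI _ Dp.
have [cX _] := sX [::] p Dp.
have cs (f : R -> E) : smooth_curve I f ->
    {for p, continuous (fun q : R * R * R => f q.1.1)}.
  by move=> sf; exact: continuous_s (smooth_continuous (n := 0%N) sf Ip).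
apply: continuous_g; last exact: cs (frenet_F_smooth frenet (i := i)).
by apply: continuousB => //; exact: cs (frenet_beta_smooth frenet).
Qed.

(** Reduces a parametrization result to finding the angles t and w, with one
    sign for the whole of D, from the normal coordinates of X - beta. *)
Lemma parametrizes_tube (A B phi psi : R -> R) (lam r : R)
    (T : bool -> R * R * R -> E)
    (C : set (R * R * R) -> (R * R * R -> E) -> Prop) :
  0 < r -> lam != 0 -> conic_pair k (- k) A B -> conic_pair k lam phi psi ->
  (forall e, T e = let q : R := (-1) ^+ e * r in
    tube (fun t => q * A t) (fun t => q * B t) phi psi q) ->
  (forall D X, tubular_hypersurface lam r I beta D X -> C D X ->
    exists e : bool, forall p, D p -> exists t w, let q : R := (-1) ^+ e * r in
    [/\ - k * g (offset X p) (F a p.1.1) = q * (A t * phi w),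
        g (offset X p) (F b p.1.1) = q * (B t * phi w) &
        g (offset X p) (F c p.1.1) = q * psi w]) ->
  parametrizes lam r I beta T C.
Proof.
move=> r0 lam0 AB PP TE coord; split=> [e D domD|D X tX CX].
  rewrite TE; set c1 := (-1) ^+ e * r.
  have c10 : c1 != 0 by rewrite mulf_neq0// ?signr_eq0// gt_eqF.
  have c2 : c1 ^+ 2 = r ^+ 2 by rewrite exprMn sqrr_sign mul1r.
  have AB' := conic_scale c1 AB; rewrite mulrC in AB'.
  have [pT qT nT] := tube_tubular AB' PP c10 lam0 domD.
  by split=> // p /qT; rewrite /hyperquadric /= c2.
have [e coorde] := coord D X tX CX.
exists e => s t w Dp; have [t' [w' [xa xb xc]]] := coorde _ Dp.
exists t', w'; have [off _] := tubular_offset tX Dp.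
rewrite -[LHS](subrK (beta s)) addrC -[X _ - _]/(offset X (s, t, w)) off.
by rewrite xa xb xc TE /tube /= !mulrA.
Qed.

(** The sphere is symmetric about its center, so either sign will do. *)
Lemma elliptic_coordinates (r : R) D X : k = -1 -> 0 < r ->
  tubular_hypersurface 1 r I beta D X ->
  exists e : bool, forall p, D p -> exists t w, let q : R := (-1) ^+ e * r in
    [/\ - k * g (offset X p) (F a p.1.1) = q * (cos t * cos w),
        g (offset X p) (F b p.1.1) = q * (sin t * cos w) &
        g (offset X p) (F c p.1.1) = q * sin w].
Proof.
move=> kE r0 tX; exists false => p Dp; rewrite expr0 mul1r.
have [_] := tubular_offset tX Dp.
set x := - k * g _ _; set y := g _ _; set z := g _ _ => q.
have [|t [w [xE yE zE]]] := @sphere_onto R (x / r) (y / r) (z / r).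
  rewrite !expr_div_n -!mulrDl; move: q; rewrite kE opprK !mul1r => ->.
  by rewrite divff// expf_neq0// gt_eqF.
by exists t, w; split; rewrite -?xE -?yE -?zE mulrC divfK// gt_eqF.
Qed.

(** On the hyperboloid of two sheets, x^2 = r^2 + y^2 + z^2 never vanishes, so
    the sign of x tells once and for all which sheet X lies on. *)
Lemma two_sheets_coordinates (r : R) D X : k = 1 -> 0 < r ->
  tubular_hypersurface (-1) r I beta D X ->
  exists e : bool, forall p, D p -> exists t w, let q : R := (-1) ^+ e * r in
    [/\ - k * g (offset X p) (F a p.1.1) = q * (cosh t * cosh w),
        g (offset X p) (F b p.1.1) = q * (sinh t * cosh w) &
        g (offset X p) (F c p.1.1) = q * sinh w].
Proof.
move=> kE r0 tX; have [[[_ cD _ _] _ _] _ _] := tX.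
have quad p : D p -> _ := fun Dp => (tubular_offset tX Dp).2.
have [||e pos] := @constant_sign R _ D
    (fun p => - k * g (offset X p) (F a p.1.1)) cD.
- move=> p Dp; apply: continuousM; first exact: cst_continuous.
  exact: (tubular_coordinate_continuous tX).
- move=> p /quad; rewrite kE; apply: contra_eq_neq => ->.
  rewrite expr0n/= mulr0 add0r mulN1r gt_eqF//.
  rewrite (@lt_le_trans _ _ 0)// ?addr_ge0 ?sqr_ge0//.
  by rewrite oppr_lt0 exprn_gt0.
exists e => p Dp; have /= := quad p Dp; have := pos p Dp.
set c1 := (-1) ^+ e * r.
have c10 : c1 != 0 by rewrite mulf_neq0// ?signr_eq0// gt_eqF.
have c2 : c1 ^+ 2 = r ^+ 2 by rewrite exprMn sqrr_sign mul1r.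
set x := - k * g _ _; set y := g _ _; set z := g _ _ => ps q.
have [||t [w [xE yE zE]]] := @two_sheets_onto R (x / c1) (y / c1) (z / c1).
- rewrite !expr_div_n -!mulrBl.
  have -> : x ^+ 2 - y ^+ 2 - z ^+ 2 = c1 ^+ 2.
    by move: q; rewrite c2 kE; lra.
  by rewrite divff// expf_neq0.
- by rewrite /c1 invr_signM mulrA [x * _]mulrC divr_gt0.
by exists t, w; split; rewrite -?xE -?yE -?zE mulrC divfK.
Qed.

(** The hyperboloid of one sheet is connected; it is the bound r < |z| that
    excludes z = 0, hence fixes the sign of z, and makes z / r a value of cosh
    with sinh nonzero. *)
Lemma one_sheet_coordinates (r : R) D X : k = 1 -> 0 < r ->
  tubular_hypersurface 1 r I beta D X -> exceeds r beta (F c) D X ->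
  exists e : bool, forall p, D p -> exists t w, let q : R := (-1) ^+ e * r in
    [/\ - k * g (offset X p) (F a p.1.1) = q * (cosh t * sinh w),
        g (offset X p) (F b p.1.1) = q * (sinh t * sinh w) &
        g (offset X p) (F c p.1.1) = q * cosh w].
Proof.
move=> kE r0 tX exX; have [[[_ cD _ _] _ _] _ _] := tX.
have quad p : D p -> _ := fun Dp => (tubular_offset tX Dp).2.
have [||e pos] := @constant_sign R _ D (fun p => g (offset X p) (F c p.1.1)) cD.
- by move=> p Dp; exact: (tubular_coordinate_continuous tX).
- by move=> p /exX; rewrite -normr_gt0; exact: lt_trans.
exists e => p Dp; have /= := quad p Dp; have := pos p Dp; have := exX p Dp.
rewrite -[X p - _]/(offset X p).
set c1 := (-1) ^+ e * r.
have c10 : c1 != 0 by rewrite mulf_neq0// ?signr_eq0// gt_eqF.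
have c2 : c1 ^+ 2 = r ^+ 2 by rewrite exprMn sqrr_sign mul1r.
set x := - k * g _ _; set y := g _ (F b _); set z := g _ (F c _) => rz ps q.
have [||t [w [xE yE zE]]] := @one_sheet_onto R (x / c1) (y / c1) (z / c1).
- rewrite !expr_div_n -mulNr -!mulrDl.
  have -> : - x ^+ 2 + y ^+ 2 + z ^+ 2 = c1 ^+ 2.
    by move: q; rewrite c2 kE; lra.
  by rewrite divff// expf_neq0.
- rewrite /c1 invr_signM mulrA [z * _]mulrC ltr_pdivlMr// mul1r.
  by move: rz; rewrite -(gtr0_norm ps) normrMsign.
by exists t, w; split; rewrite -?xE -?yE -?zE mulrC divfK.
Qed.

(** On the cone x^2 = y^2 + z^2, the free functions are the coordinates y and z
    themselves. The coordinate x vanishes only together with y and z, that is at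
    the vertex, so away from it x keeps its sign. *)
Lemma parametrizes_null_cone (r : R)
    (T : bool -> (R * R * R -> R) -> (R * R * R -> R) -> R * R * R -> E) :
  k = 1 ->
  (forall e y z p, T e y z p = beta p.1.1 + normal_comb p.1.1
     ((-1) ^+ e * Num.sqrt (y p ^+ 2 + z p ^+ 2)) (y p) (z p)) ->
  parametrizes_null r I beta T.
Proof.
move=> kE TE; split=> [e y z D pT|D X tX].
  have [domD _ _] := pT; have [_ _ _ DI] := domD.
  have off p : offset (T e y z) p = normal_comb p.1.1
     ((-1) ^+ e * Num.sqrt (y p ^+ 2 + z p ^+ 2)) (y p) (z p).
    by rewrite /offset TE addrC addKr.
  apply/(tubularP domD) => // p /DI Ip.
    rewrite /hyperquadric /= -[X in g X X]/(offset _ p) off.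
    rewrite g_normal_comb_self// kE exprMn sqrr_sign mul1r.
    by rewrite sqr_sqrtr ?addr_ge0 ?sqr_ge0//; ring.
  by rewrite off; have [] := g_normal_comb
    ((-1) ^+ e * Num.sqrt (y p ^+ 2 + z p ^+ 2)) (y p) (z p) Ip.
pose x p := - k * g (offset X p) (F a p.1.1).
pose y p := g (offset X p) (F b p.1.1).
pose z p := g (offset X p) (F c p.1.1).
have XE p : D p -> X p = beta p.1.1 + normal_comb p.1.1 (x p) (y p) (z p).
  by move=> /(tubular_offset tX)[<- _]; rewrite /offset addrC subrK.
have sqrtE p : D p -> Num.sqrt (y p ^+ 2 + z p ^+ 2) = `|x p|.
  move=> /(tubular_offset tX)[_]; rewrite -sqrtr_sqr -/(x p) -/(y p) -/(z p).
  by rewrite kE => q; congr Num.sqrt; lra.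
exists y, z; split=> [p Dp|apex].
  exists (x p < 0); rewrite XE// TE sqrtE//; congr (_ + normal_comb _ _ _ _).
  by rewrite -realEsign// num_real.
have [[[_ cD _ _] _ _] _ _] := tX.
have [||e pos] := @constant_sign R _ D x cD.
- move=> p Dp; apply: continuousM; first exact: cst_continuous.
  exact: (tubular_coordinate_continuous tX).
- move=> p Dp; apply: contra_notN (apex p Dp) => /eqP x0.
  have := sqrtE p Dp; rewrite x0 normr0 => /eqP; rewrite sqrtr_eq0 => yz.
  have : y p ^+ 2 + z p ^+ 2 == 0.
    by rewrite eq_le yz addr_ge0// sqr_ge0.
  rewrite paddr_eq0 ?sqr_ge0// !sqrf_eq0 => /andP[/eqP y0 /eqP z0].
  by rewrite XE// x0 y0 z0 /normal_comb !scale0r !addr0.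
exists e => p Dp; rewrite XE// TE sqrtE//; congr (_ + normal_comb _ _ _ _).
by rewrite -(normrMsign e) (gtr0_norm (pos p Dp)) signrMK.
Qed.

End AdaptedFrame.

End Envelope.

(** * Parametrization of tubular hypersurfaces *)

Ltac tube_formula :=
  move=> e; apply/funext => -[[s t] w]; rewrite /tube /normal_comb /=;
  apply/rowP => i; rewrite !mxE; ring.

Theorem theorem9 (R : realType) (r : R) (I : set R) (j : 'I_4)
    (beta : R -> 'rV[R]_4) (F : 'I_4 -> R -> 'rV[R]_4) (k1 k2 k3 : R -> R)
    (r_gt0 : 0 < r) (openI : open I) (intervalI : is_interval I)
    (frenet : frenet_curve I j beta F k1 k2 k3) :
  (j = i1 -> parametrizes 1 r I beta (T11 r beta F) (@everywhere R)) /\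
  (j = i2 -> parametrizes 1 r I beta (T21 r beta F) (exceeds r beta (F i3))) /\
  (j = i2 -> parametrizes (-1) r I beta (T2m1 r beta F) (@everywhere R)) /\
  (j = i3 -> parametrizes 1 r I beta (T31 r beta F) (exceeds r beta (F i4))) /\
  (j = i3 -> parametrizes (-1) r I beta (T3m1 r beta F) (@everywhere R)) /\
  (j = i4 -> parametrizes 1 r I beta (T41 r beta F) (exceeds r beta (F i2))) /\
  (j = i4 -> parametrizes (-1) r I beta (T4m1 r beta F) (@everywhere R)) /\
  (j = i1 -> ~ exists D X, tubular_hypersurface (-1) r I beta D X) /\
  (j = i2 -> parametrizes_null r I beta (T20 beta F)) /\
  (j = i3 -> parametrizes_null r I beta (T30 beta F)) /\
  (j = i4 -> parametrizes_null r I beta (T40 beta F)).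
Proof.
have signature_self m : signature R m m = 1 by rewrite /signature /eps eqxx opprK.
have signature_i1 : signature R i1 i2 = -1 by [].
have N1_neq0 : -1 != 0 :> R by rewrite oppr_eq0 oner_eq0.
(* For j <> 1 the timelike direction F_j takes the first slot of the frame. *)
have one_sheet (b c : 'I_4) (T : bool -> R * R * R -> 'rV[R]_4) :
    uniq [:: i1; j; b; c] ->
    (forall e, T e = let q := (-1) ^+ e * r in tube beta F j b c
      (fun t => q * cosh t) (fun t => q * sinh t) (@sinh R) (@cosh R) q) ->
    parametrizes 1 r I beta T (exceeds r beta (F c)).
  move=> u TE; have jj : j \in [:: i1; j] by rewrite !inE eqxx orbT.
  apply: (parametrizes_tube frenet u jj r_gt0 (oner_neq0 R) _ _ TE).
  - by rewrite signature_self; exact: conic_cosh_sinh.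
  - by rewrite signature_self; exact: conic_sinh_cosh.
  - move=> D X.
    exact: (one_sheet_coordinates frenet u jj (signature_self j) r_gt0).
have two_sheets (b c : 'I_4) (T : bool -> R * R * R -> 'rV[R]_4) :
    uniq [:: i1; j; b; c] ->
    (forall e, T e = let q := (-1) ^+ e * r in tube beta F j b c
      (fun t => q * cosh t) (fun t => q * sinh t) (@cosh R) (@sinh R) q) ->
    parametrizes (-1) r I beta T (@everywhere R).
  move=> u TE; have jj : j \in [:: i1; j] by rewrite !inE eqxx orbT.
  apply: (parametrizes_tube frenet u jj r_gt0 N1_neq0 _ _ TE).
  - by rewrite signature_self; exact: conic_cosh_sinh.
  - by rewrite signature_self; exact: conic_cosh_sinh.
  - move=> D X tX _.
    exact: (two_sheets_coordinates frenet u jj (signature_self j) r_gt0 tX).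
have cone (b c : 'I_4)
    (T : bool -> (R * R * R -> R) -> (R * R * R -> R) -> R * R * R -> 'rV[R]_4) :
    uniq [:: i1; j; b; c] ->
    (forall e y z p, T e y z p = beta p.1.1 + normal_comb F j b c p.1.1
     ((-1) ^+ e * Num.sqrt (y p ^+ 2 + z p ^+ 2)) (y p) (z p)) ->
    parametrizes_null r I beta T.
  move=> u TE; have jj : j \in [:: i1; j] by rewrite !inE eqxx orbT.
  exact: (parametrizes_null_cone frenet u jj r (signature_self j) TE).
do !apply: conj.
- move=> ?; subst j.
  apply: (parametrizes_tube frenet (a := i2) (b := i3) (c := i4) isT isT r_gt0
    (oner_neq0 R)).
  + by rewrite signature_i1 opprK; exact: conic_trig.
  + by rewrite signature_i1; exact: conic_trig.
  + tube_formula.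
  + by move=> D X tX _; exact: (elliptic_coordinates frenet
      (a := i2) (b := i3) (c := i4) isT isT signature_i1 r_gt0 tX).
- move=> ?; subst j; apply: (one_sheet i4 i3) => //; tube_formula.
- move=> ?; subst j; apply: (two_sheets i4 i3) => //; tube_formula.
- move=> ?; subst j; apply: (one_sheet i2 i4) => //; tube_formula.
- move=> ?; subst j; apply: (two_sheets i2 i4) => //; tube_formula.
- move=> ?; subst j; apply: (one_sheet i3 i2) => //; tube_formula.
- move=> ?; subst j; apply: (two_sheets i3 i2) => //; tube_formula.
- move=> ? [D [X tX]]; subst j.
  have [[[_ _ [p Dp] _] _ _] _ _] := tX.
  (* All three normal directions are spacelike: a sum of three squares cannot
     equal -r^2. *)
  have [_] := tubular_offset frenet (a := i2) (b := i3) (c := i4) isT isT tX Dp.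
  apply/eqP; rewrite signature_i1 opprK !mul1r gt_eqF//.
  rewrite (@lt_le_trans _ _ 0)// ?addr_ge0 ?sqr_ge0//.
  by rewrite mulN1r oppr_lt0 exprn_gt0.
- move=> ?; subst j; apply: (cone i3 i4) => // e y z p.
  by rewrite /T20 /normal_comb !addrA.
- move=> ?; subst j; apply: (cone i2 i4) => // e y z p.
  by rewrite /T30 /normal_comb; apply/rowP => i; rewrite !mxE; ring.
- move=> ?; subst j; apply: (cone i2 i3) => // e y z p.
  by rewrite /T40 /normal_comb; apply/rowP => i; rewrite !mxE; ring.
Qed.
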